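(* If $X$ is a finite metric space of negative type, then $\mathrm{Mag}(X) \le \# X$, where $\# X$ denotes the number of points of $X$.
   Context: For a finite metric space $X = \{1,\dots,n\}$ with metric $d$, the zeta matrix is the real $n\times n$ matrix $Z_X = (e^{-d(i,j)})_{i,j}$. A weighting on $X$ is a vector $w \in \mathbb{R}^n$ with $Z_X w = \mathbf{1}$, where $\mathbf{1}\in\mathbb{R}^n$ is the vector with all entries $1$. If a weighting $w$ exists, the magnitude is $\mathrm{Mag}(X) = \langle w, \mathbf{1}\rangle = \sum_i w_i$ (independent of the choice of $w$). If $Z_X$ is invertible, then $\mathrm{Mag}(X) = \langle \mathbf{1}, Z_X^{-1}\mathbf{1}\rangle$, the sum of the entries of $Z_X^{-1}$. For a real number $t>0$, $tX$ denotes the rescaled metric space $(X, td)$. A finite metric space $X$ is positive definite if $Z_X$ is a positive definite matrix, and is of negative type if $Z_{tX}$ is positive definite for every $t>0$. *)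

(* Defs.v *)
From HB Require Import structures.
From mathcomp Require Import all_boot all_order all_algebra.
From mathcomp Require Import all_classical all_reals sequences exp.

Set Implicit Arguments.
Unset Strict Implicit.
Unset Printing Implicit Defensive.

Import Order.TTheory GRing.Theory Num.Theory.

Local Open Scope classical_set_scope.
Local Open Scope ring_scope.

(* A record rather than the library's [metricType], which attaches one metric
   to each carrier type: here the metric varies (rescaling) while the set of
   points 'I_n stays fixed. *)
Record finMetric (R : realType) (n : nat) := FinMetric {
  dist :> 'I_n -> 'I_n -> R ;
  dist_ge0 : forall i j, 0 <= dist i j ;
  dist_eq0 : forall i j, dist i j = 0 <-> i = j ;
  dist_sym : forall i j, dist i j = dist j i ;
  dist_triangle : forall i j k, dist i k <= dist i j + dist j k
}.

Section Rescale.
Variables (R : realType) (n : nat) (t : R) (t_gt0 : 0 < t) (X : finMetric R n).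

Fact rescale_ge0 i j : 0 <= t * X i j.
Proof. by rewrite mulr_ge0 ?dist_ge0 // ltW. Qed.

Fact rescale_eq0 i j : t * X i j = 0 <-> i = j.
Proof.
split=> [/eqP|/dist_eq0->]; last by rewrite mulr0.
by rewrite mulf_eq0 gt_eqF //= => /eqP/dist_eq0.
Qed.

Fact rescale_sym i j : t * X i j = t * X j i.
Proof. by rewrite dist_sym. Qed.

Fact rescale_triangle i j k : t * X i k <= t * X i j + t * X j k.
Proof. by rewrite -mulrDr ler_pM2l // dist_triangle. Qed.

Definition rescale : finMetric R n :=
  FinMetric rescale_ge0 rescale_eq0 rescale_sym rescale_triangle.

End Rescale.

Definition zeta (R : realType) (n : nat) (X : finMetric R n) : 'M[R]_n :=
  \matrix_(i, j) expR (- X i j).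

Definition posdefmx (R : realType) (n : nat) (A : 'M[R]_n) : Prop :=
  A^T = A /\ forall v : 'cV[R]_n, v != 0 -> 0 < (v^T *m A *m v) 0 0.

Definition positive_definite (R : realType) (n : nat) (X : finMetric R n) :
  Prop := posdefmx (zeta X).

Definition negative_type (R : realType) (n : nat) (X : finMetric R n) : Prop :=
  forall (t : R) (t_gt0 : 0 < t), positive_definite (rescale t_gt0 X).

Definition weighting (R : realType) (n : nat) (X : finMetric R n) :
  set 'cV[R]_n := [set w | zeta X *m w = const_mx 1].

(* [xget] picks some weighting; when there is none the value is the junk 0.
   [magnitudeE] and [weighting_ex] show that the choice is irrelevant and that
   the junk value does not occur for spaces of negative type. *)
Definition magnitude (R : realType) (n : nat) (X : finMetric R n) : R :=
  \sum_i (xget 0 (weighting X)) i 0.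

Section Magnitude.
Variables (R : realType) (n : nat) (X : finMetric R n).

Lemma zeta_sym : (zeta X)^T = zeta X.
Proof. by apply/matrixP => i j; rewrite !mxE dist_sym. Qed.

Lemma weighting_sum_unique (v w : 'cV[R]_n) : weighting X v -> weighting X w ->
  \sum_i v i 0 = \sum_i w i 0.
Proof.
have sumE (u : 'cV[R]_n) : \sum_i u i 0 = ((const_mx 1 : 'cV_n)^T *m u) 0 0.
  by rewrite mxE; apply: eq_bigr => i _; rewrite !mxE mul1r.
rewrite /weighting /= => vP wP.
have -> : \sum_i v i 0 = (v^T *m const_mx 1 : 'M_1) 0 0.
  by rewrite mxE; apply: eq_bigr => i _; rewrite !mxE mulr1.
by rewrite sumE -{1}wP -vP trmx_mul zeta_sym mulmxA.
Qed.

Lemma magnitudeE (w : 'cV[R]_n) :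
  weighting X w -> magnitude X = \sum_i w i 0.
Proof.
by move=> wP; apply: weighting_sum_unique => //; exact: (xgetI 0 wP).
Qed.

Lemma posdefmx_unit (A : 'M[R]_n) : posdefmx A -> A \in unitmx.
Proof.
move=> [AT Apos]; rewrite -row_free_unit -kermx_eq0.
apply/rowV0P => v /sub_kermxP vA0; apply/eqP/negP => /negP v0.
have /Apos : v^T != 0 by rewrite trmx_eq0.
by rewrite trmxK vA0 mul0mx mxE ltxx.
Qed.

Lemma negative_type_positive_definite :
  negative_type X -> positive_definite X.
Proof.
move=> /(_ 1 ltr01); rewrite /positive_definite.
suff -> : zeta (rescale ltr01 X) = zeta X by [].
by apply/matrixP => i j; rewrite !mxE /= mul1r.
Qed.

Lemma weighting_ex : negative_type X ->
  weighting X (invmx (zeta X) *m const_mx 1).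
Proof.
move=> /negative_type_positive_definite/posdefmx_unit Zu.
by rewrite /weighting /= mulmxA mulmxV // mul1mx.
Qed.

End Magnitude.

(* Main.v *)
Require Import Defs.
From mathcomp Require Import all_boot all_order all_algebra.
From mathcomp Require Import all_classical all_reals.
From mathcomp Require Import sequences exp lra.

Import Order.TTheory GRing.Theory Num.Theory.

Local Open Scope ring_scope.

(** Negative type makes A = Z_{X/2} positive definite, so A = B B^T, and Z_X is
    the entrywise square of A.  Let w be the weighting of X, W the diagonal
    matrix with entries w, and M = B^T W B, a symmetric n x n matrix.  Then
    tr M = tr (W A) = Mag(X), since A has unit diagonal, and
    tr (M M) = tr (W A W A) = w^T Z_X w = Mag(X).  Hence
    0 <= tr ((M - I)^2) = Mag(X) - 2 Mag(X) + n. *)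

Lemma mxtrace_mulmx_trmx_ge0 {R : realDomainType} {m n : nat}
  (M : 'M[R]_(m, n)) : 0 <= \tr (M *m M^T).
Proof.
apply: sumr_ge0 => i _; rewrite mxE; apply: sumr_ge0 => j _.
by rewrite mxE -expr2 sqr_ge0.
Qed.

Lemma posdefmx_diag_gt0 {R : realType} {n : nat} {A : 'M[R]_n} :
  posdefmx A -> forall i, 0 < A i i.
Proof.
move=> [_ Apos] i; have : delta_mx i 0 != 0 :> 'cV[R]_n.
  by apply/negP => /eqP/matrixP/(_ i 0)/eqP; rewrite !mxE !eqxx oner_eq0.
by move=> /Apos; rewrite trmx_delta -rowE -colE !mxE.
Qed.

Lemma posdefmx_schur_complement {R : realType} {n : nat}
  {a : R} {r : 'rV[R]_n} {D : 'M[R]_n} :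
  a != 0 -> posdefmx (block_mx a%:M r r^T D) ->
  posdefmx (D - a^-1 *: (r^T *m r)).
Proof.
move=> a0 [AT Apos]; split.
  move: AT; rewrite tr_block_mx => /eq_block_mx [_ _ _ DT].
  by rewrite linearB linearZ /= trmx_mul trmxK DT.
(* The first coordinate of [v] is chosen so that the block matrix sends [v] to a column with zero
   top entry and bottom block [(D - a^-1 *: (r^T *m r)) *m u]. Its quadratic form at [v] is thus
   that of the Schur complement at [u]. *)
move=> u u0; pose v : 'cV[R]_(1 + n) := col_mx (- a^-1 *: (r *m u)) u.
have /Apos : v != 0.
  apply: contra u0 => /eqP /(congr1 dsubmx).
  by rewrite col_mxKd => ->; rewrite linear0.
rewrite -mulmxA mul_block_col tr_col_mx mul_row_col.
rewrite mul_scalar_mx scalerA mulrN mulfV // scaleN1r addNr mulmx0 add0r.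
rewrite -scalemxAr scaleNr addrC mulmxA scalemxAl -mulmxBl.
by rewrite mulmxA.
Qed.

(** Cholesky factorization by induction on the size: the first row and column are split off, and the
    induction hypothesis factors the Schur complement of the corner entry, which is again positive
    definite. *)
Lemma posdefmx_cholesky {R : realType} {n : nat} {A : 'M[R]_n} :
  posdefmx A -> exists B : 'M[R]_n, A = B *m B^T.
Proof.
elim: n A => [|n IHn] A Apd.
  by exists 0; apply/matrixP => -[].
have a_gt0 := posdefmx_diag_gt0 Apd 0.
move: A Apd a_gt0; rewrite -[n.+1]/(1 + n)%N => A Apd a_gt0.
set a := A 0 0 in a_gt0; set r : 'rV[R]_n := ursubmx A.
have AE : A = block_mx a%:M r r^T (drsubmx A).
  rewrite -{1}[A]submxK; congr block_mx.
    rewrite [LHS]mx11_scalar !mxE /a; congr (A _ _)%:M; exact: val_inj.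
  by rewrite /r -{1}Apd.1 -trmx_ursub.
move: Apd; rewrite AE; move: (drsubmx A) => D Apd.
have a0 : a != 0 by rewrite gt_eqF.
have [B BE] := IHn _ (posdefmx_schur_complement a0 Apd).
have ss : Num.sqrt a * Num.sqrt a = a by rewrite -expr2 sqr_sqrtr // ltW.
have s0 : Num.sqrt a != 0 by rewrite gt_eqF // sqrtr_gt0.
(* The first column is that of [A] divided by the square root of [a]. In the product it contributes
   [a^-1 *: (r^T *m r)] to the lower right block, exactly what the Schur complement [B *m B^T] lacks
   to give [D]. *)
exists (block_mx (Num.sqrt a)%:M 0 ((Num.sqrt a)^-1 *: r^T) B).
rewrite tr_block_mx mulmx_block !trmx0 !mul0mx !mulmx0 !addr0.
rewrite tr_scalar_mx -scalar_mxM ss linearZ /= trmxK.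
rewrite mul_scalar_mx scalerA mulfV // scale1r.
rewrite mul_mx_scalar scalerA mulfV // scale1r.
by rewrite -scalemxAl -scalemxAr scalerA -invfM ss -BE addrC subrK.
Qed.

Lemma mxtrace_diag_mul {R : pzSemiRingType} {n : nat} (w : 'rV[R]_n)
  (A : 'M[R]_n) : \tr (diag_mx w *m A) = \sum_i w 0 i * A i i.
Proof. by apply: eq_bigr => i _; rewrite mul_diag_mx mxE. Qed.

Theorem theorem1p1 (R : realType) (n : nat) (X : finMetric R n)
  (hX : negative_type X) : magnitude X <= n%:R.
Proof.
have half_gt0 : 0 < 2^-1 :> R by rewrite invr_gt0 ltr0n.
pose A := zeta (rescale half_gt0 X).
have [B AE] : exists B, A = B *m B^T := posdefmx_cholesky (hX _ half_gt0).
have AA i j : A i j * A j i = zeta X i j.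
  rewrite !mxE /= -expRD (dist_sym X j i); congr expR; lra.
have Aii i : A i i = 1.
  by rewrite mxE /= (dist_eq0 X i i).2 // mulr0 oppr0 expR0.
have := weighting_ex hX; set w := _ *m _ => wP.
rewrite (magnitudeE wP); set m := \sum_i _.
pose W := diag_mx w^T; pose M := B^T *m W *m B.
have MT : M^T = M by rewrite /M !trmx_mul trmxK tr_diag_mx mulmxA.
have trM : \tr M = m.
  rewrite /M -mulmxA mxtrace_mulC -mulmxA -AE mxtrace_diag_mul.
  by apply: eq_bigr => i _; rewrite Aii mulr1 mxE.
have trMM : \tr (M *m M) = m.
  rewrite /M -!mulmxA mxtrace_mulC -!mulmxA -AE mxtrace_diag_mul.
  (* The factor of [w i 0] is the diagonal entry of A W A at i, that is the sum over j of
     [A i j * w j 0 * A j i]. By [AA] this is entry i of [zeta X *m w], which is 1 as [w] is a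
     weighting. *)
  apply: eq_bigr => i _; rewrite mulmxA -AE.
  have /matrixP/(_ i 0) := wP; rewrite !mxE => wi.
  rewrite -[RHS]mulr1 -wi; congr (_ * _); apply: eq_bigr => j _.
  by rewrite mul_diag_mx -AA !mxE mulrCA mulrC.
have := mxtrace_mulmx_trmx_ge0 (M - 1%:M).
rewrite linearB /= MT trmx1 mulmxBl !mulmxBr !mul1mx mulmx1.
rewrite !linearB /= mxtrace1 trM trMM; lra.
Qed.
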